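(* For all $X,Y\in\Gamma(D)$ and $\xi\in\Gamma(D^{\bot})$, $$\pi^{D^\bot}\big(\widetilde{R}(X,Y)\xi\big)=-\widetilde{B}(X,\widetilde{A}_{\xi}Y)+\widetilde{B}(Y,\widetilde{A}_{\xi}X)+\widetilde{R}^{L^{\bot}}(X,Y)\xi,$$ where $$\widetilde{R}^{L^{\bot}}(X,Y)\xi:=L^{\bot}_XL^{\bot}_Y\xi-L^{\bot}_YL^{\bot}_X\xi-L^{\bot}_{[X,Y]^D}\xi-\pi^{D^{\bot}}\widetilde{\nabla}_{[X,Y]^{D^\bot}}\xi.$$
   Context: $(M,g)$ is a smooth Riemannian manifold with Levi-Civita connection $\nabla$. $D\subseteq TM$ is a smooth subbundle (distribution) of constant rank $n$ that is non integrable, i.e. there are $X,Y\in\Gamma(D)$ with $[X,Y]\notin\Gamma(D)$. $D^\bot$ is its orthogonal complement, $\pi^D:TM\to D$ and $\pi^{D^\bot}:TM\to D^\bot$ are the orthogonal projections, $[X,Y]^D=\pi^D[X,Y]$, $[X,Y]^{D^\bot}=\pi^{D^\bot}[X,Y]$. For $X,Y\in\Gamma(D)$, $B(X,Y)=\pi^{D^\bot}(\nabla_XY)$. $U$ is a vector field on $M$, $\omega(V)=g(U,V)$. The semi-symmetric metric connection on $M$ is $\widetilde\nabla_XY=\nabla_XY+\omega(Y)X-g(X,Y)U$. For $X,Y\in\Gamma(D)$ put $\widetilde B(X,Y)=\pi^{D^\bot}(\widetilde\nabla_XY)$. For $\xi\in\Gamma(D^\bot)$ the shape operator $A_\xi:\Gamma(D)\to\Gamma(D)$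 is defined by $g(A_\xi X,Y)=g(B(X,Y),\xi)$ for $X,Y\in\Gamma(D)$, and $\widetilde A_\xi=A_\xi-\omega(\xi)\,\mathrm{Id}$. For $X\in\Gamma(D)$, $\xi\in\Gamma(D^\bot)$ put $L^\bot_X\xi=\pi^{D^\bot}(\nabla_X\xi)$. The curvature of $\widetilde\nabla$ is $\widetilde R(X,Y)Z=\widetilde\nabla_X\widetilde\nabla_YZ-\widetilde\nabla_Y\widetilde\nabla_XZ-\widetilde\nabla_{[X,Y]}Z$ for all vector fields on $M$. *)

(* Defs.v *)
(* Smooth manifolds are Hausdorff, second countable, without boundary, with
   an atlas (not necessarily maximal) of charts into R^m.  Tangent vectors
   are derivations of the algebra C^oo(M) at a point, and vector fields are
   smooth sections of the tangent bundle; they form a module over C^oo(M). *)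
From HB Require Import structures.
From mathcomp Require Import all_boot all_order all_algebra.
From mathcomp Require Import all_classical all_reals all_analysis.
From mathcomp Require Import ring.

Set Implicit Arguments.
Unset Strict Implicit.
Unset Printing Implicit Defensive.

Import Order.TTheory GRing.Theory Num.Theory.
Import numFieldNormedType.Exports.

Local Open Scope classical_set_scope.
Local Open Scope ring_scope.

Section Euclidean.
Context {R : realType} {m : nat}.
Implicit Types (U V : set 'rV[R]_m) (f h : 'rV[R]_m -> R).

(* Meant for open U: continuity and derivatives are taken in R^m, not in U. *)
Fixpoint Ck (k : nat) U f : Prop :=
  (forall x, U x -> {for x, continuous f}) /\
  match k with
  | 0 => True
  | k'.+1 => forall i : 'I_m,
      (forall x, U x -> derivable f x (delta_mx 0 i)) /\
      Ck k' U (fun x => 'D_(delta_mx 0 i) f x)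
  end.

Definition Csmooth U f : Prop := forall k, Ck k U f.

Lemma Ck_pred k U f : Ck k.+1 U f -> Ck k U f.
Proof.
elim: k f => [|k IH] f; first by case.
move=> [cf H]; split=> // i; have [d Hd] := H i.
by split=> //; exact: IH.
Qed.

Lemma Ck_ext k U f h :
  open U -> (forall x, U x -> f x = h x) -> Ck k U f -> Ck k U h.
Proof.
move=> oU; elim: k f h => [|k IH] f h fh.
all: have E x : U x -> \near x, f x = h x
  by move=> Ux; apply: filterS fh _; exact: open_nbhs_nbhs.
all: have C : (forall x, U x -> {for x, continuous f}) ->
    forall x, U x -> {for x, continuous h}.
- move=> cf x Ux; have := cf x Ux; rewrite /prop_for /continuous_at.
  rewrite -fh //; apply: cvg_trans; exact: near_eq_cvg (E x Ux).
- by move=> [cf _]; split=> //; exact: C.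
- move=> cf x Ux; have := cf x Ux; rewrite /prop_for /continuous_at.
  rewrite -fh //; apply: cvg_trans; exact: near_eq_cvg (E x Ux).
move=> [cf H]; split; first exact: C.
move=> i; have [d Hd] := H i; split.
  move=> x Ux; by apply: near_eq_derivable (d x Ux); exact: E.
apply: IH Hd => x Ux; by apply: near_eq_derive; exact: E.
Qed.

Lemma Ck_cst k U (a : R) : open U -> Ck k U (cst a).
Proof.
move=> oU; elim: k a => [|k IH] a; first by split=> // x _; exact: cst_continuous.
split=> [x _|i]; first exact: cst_continuous.
split=> [x _|]; first exact: derivable_cst.
by apply: (Ck_ext oU _ (IH 0)) => x _; rewrite derive_cst.
Qed.

Lemma CkD k U f h : open U -> Ck k U f -> Ck k U h -> Ck k U (f + h).
Proof.
move=> oU; elim: k f h => [|k IH] f h [cf Hf] [ch Hh].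
  by split=> // x Ux; apply: continuousD; [exact: cf | exact: ch].
split=> [x Ux|i]; first by apply: continuousD; [exact: cf | exact: ch].
have [[df Df] [dh Dh]] := (Hf i, Hh i); split=> [x Ux|].
  by apply: derivableD; [exact: df | exact: dh].
apply: (Ck_ext oU _ (IH _ _ Df Dh)) => x Ux.
by rewrite deriveD //; [exact: df | exact: dh].
Qed.

Lemma CkM k U f h : open U -> Ck k U f -> Ck k U h -> Ck k U (f * h).
Proof.
move=> oU; elim: k f h => [|k IH] f h Cf Ch.
  have [[cf _] [ch _]] := (Cf, Ch).
  by split=> // x Ux; apply: continuousM; [exact: cf | exact: ch].
have [[cf Hf] [ch Hh]] := (Cf, Ch).
split=> [x Ux|i]; first by apply: continuousM; [exact: cf | exact: ch].
have [[df Df] [dh Dh]] := (Hf i, Hh i); split=> [x Ux|].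
  by apply: derivableM; [exact: df | exact: dh].
have H1 := IH _ _ (Ck_pred Cf) Dh; have H2 := IH _ _ (Ck_pred Ch) Df.
apply: (Ck_ext oU _ (CkD oU H1 H2)) => x Ux.
by rewrite deriveM //; [exact: df | exact: dh].
Qed.

End Euclidean.

Record chart (R : realType) (m : nat) (M : topologicalType) := Chart {
  chart_dom : set M;
  chart_map :> M -> 'rV[R]_m;
  chart_inv : 'rV[R]_m -> M;
  chart_dom_open : open chart_dom;
  chart_img_open : open (chart_map @` chart_dom);
  chart_continuous : {within chart_dom, continuous chart_map};
  chart_inv_continuous :
    {within chart_map @` chart_dom, continuous chart_inv};
  chart_mapK : {in chart_dom, cancel chart_map chart_inv}
}.

Definition charts_compatible (R : realType) (m : nat) (M : topologicalType)
    (c1 c2 : chart R m M) : Prop :=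
  forall j : 'I_m, Csmooth (c1 @` (chart_dom c1 `&` chart_dom c2))
    (fun x => c2 (chart_inv c1 x) 0 j).

Record smooth_manifold (R : realType) (m : nat) := SmoothManifold {
  carrier :> topologicalType;
  manifold_hausdorff : hausdorff_space carrier;
  manifold_second_countable : @second_countable carrier;
  atlas : set (chart R m carrier);
  atlas_cover : forall p, exists2 c, atlas c & chart_dom c p;
  atlas_compatible : forall c1 c2,
    atlas c1 -> atlas c2 -> charts_compatible c1 c2
}.

Section SmoothFunctions.
Context {R : realType} {m : nat} (M : smooth_manifold R m).

(* Meant for open V. *)
Definition smooth_on (V : set M) (f : M -> R) : Prop :=
  forall c, atlas c ->
    Csmooth (c @` (chart_dom c `&` V)) (f \o chart_inv c).

Definition smooth : {pred M -> R} := [pred f | `[< smooth_on setT f >]].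

Lemma smooth_subring : subring_closed smooth.
Proof.
have o (c : chart R m M) : open (c @` (chart_dom c `&` setT)).
  by rewrite setIT; exact: chart_img_open.
have D f h : f \in smooth -> h \in smooth -> f + h \in smooth.
  move=> /asboolP Hf /asboolP Hh; apply/asboolP => c ac k.
  by have := CkD (o c) (Hf c ac k) (Hh c ac k).
have P f h : f \in smooth -> h \in smooth -> f * h \in smooth.
  move=> /asboolP Hf /asboolP Hh; apply/asboolP => c ac k.
  by have := CkM (o c) (Hf c ac k) (Hh c ac k).
have C a : cst a \in smooth.
  by apply/asboolP => c ac k; have := Ck_cst k a (o c).
split=> //; first exact: C.
move=> f h Hf Hh; apply: D => //.
suff -> : - h = cst (-1) * h by apply: P.
by apply/funext => x; rewrite /GRing.mul /GRing.opp /= mulN1r.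
Qed.

Lemma smooth_cst (a : R) : cst a \in smooth.
Proof.
apply/asboolP => c ac k; have := @Ck_cst R m k _ a (@chart_img_open _ _ _ c).
by rewrite setIT.
Qed.

Record Cinf := MkCinf { Cinf_fun :> M -> R; _ : Cinf_fun \in smooth }.

HB.instance Definition _ := [isSub for Cinf_fun].
HB.instance Definition _ := [Choice of Cinf by <:].
HB.instance Definition _ :=
  GRing.SubChoice_isSubComPzRing.Build (M -> R) smooth Cinf smooth_subring.

Definition Cinf_cst (a : R) : Cinf := MkCinf (smooth_cst a).

Lemma Cinf_ext (f h : Cinf) : (forall p, f p = h p) -> f = h.
Proof. by move=> fh; apply/val_inj/funext. Qed.

Lemma Cinf_smooth (f : Cinf) : (f : M -> R) \in smooth.
Proof. by case: f. Qed.

Lemma CinfDE (f h : Cinf) p : (f + h) p = f p + h p. Proof. by []. Qed.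
Lemma CinfNE (f : Cinf) p : (- f) p = - f p. Proof. by []. Qed.
Lemma CinfME (f h : Cinf) p : (f * h) p = f p * h p. Proof. by []. Qed.

End SmoothFunctions.
Arguments smooth {R m M}.

Section TangentVectors.
Context {R : realType} {m : nat} {M : smooth_manifold R m}.
Implicit Types (p : M) (f h : Cinf M).

Definition derivation_at p : {pred Cinf M -> R^o} := [pred v | `[<
  (forall (a : R) f h, v (Cinf_cst M a * f + h) = a * v f + v h) /\
  (forall f h, v (f * h) = v f * h p + f p * v h) >]].

Lemma derivation_at_submod p : submod_closed (derivation_at p).
Proof.
split=> [|a u v /asboolP[ul uM] /asboolP[vl vM]]; apply/asboolP.
  by split=> *; rewrite /GRing.zero /= ?(mulr0, mul0r, addr0).
have E w : (a *: u + v) w = a * u w + v w by [].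
split=> *; rewrite !E ?ul ?vl ?uM ?vM; ring.
Qed.

HB.instance Definition _ p :=
  GRing.isSubmodClosed.Build R (Cinf M -> R^o) (derivation_at p)
    (derivation_at_submod p).

Record tangent p := MkTangent {
  tangent_fun :> Cinf M -> R^o;
  _ : tangent_fun \in derivation_at p
}.

HB.instance Definition _ p := [isSub for @tangent_fun p].
HB.instance Definition _ p := [Choice of tangent p by <:].
HB.instance Definition _ p := [SubChoice_isSubLmodule of tangent p by <:].

Lemma tangent_ext p (u v : tangent p) : (forall f, u f = v f) -> u = v.
Proof. by move=> uv; apply/val_inj/funext. Qed.

Lemma tangentM p (v : tangent p) f h : v (f * h) = v f * h p + f p * v h.
Proof. by case: v => v /= /asboolP[]. Qed.

Lemma tangent_lin p (v : tangent p) (a : R) f h :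
  v (Cinf_cst M a * f + h) = a * v f + v h.
Proof. by case: v => v /= /asboolP[]. Qed.

Lemma tangentD p (v : tangent p) f h : v (f + h) = v f + v h.
Proof.
have := tangent_lin v 1 f h; rewrite mul1r; congr (v (_ + _) = _).
by apply: Cinf_ext => q; rewrite CinfME mul1r.
Qed.

Lemma tangentB p (v : tangent p) f h : v (f - h) = v f - v h.
Proof. by apply/eqP; rewrite eq_sym subr_eq -tangentD subrK. Qed.

End TangentVectors.
Arguments tangent {R m M} p.

Section VectorFields.
Context {R : realType} {m : nat} {M : smooth_manifold R m}.

(* Meant for open V; the values of v outside V are irrelevant. *)
Definition smooth_section_on (V : set M) (v : forall p : M, tangent p) : Prop :=
  forall f : Cinf M, smooth_on V (fun p => v p f).

Record vfield := MkVfield {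
  vfield_at :> forall p : M, tangent p;
  vfield_smooth : smooth_section_on setT vfield_at
}.

HB.instance Definition _ := gen_eqMixin vfield.
HB.instance Definition _ := gen_choiceMixin vfield.

Lemma vfield_ext (X Y : vfield) : (forall p, X p = Y p) -> X = Y.
Proof.
case: X Y => X sX [Y sY] /= XY.
have {}XY : X = Y by apply: functional_extensionality_dep.
by rewrite XY in sX *; congr MkVfield; exact: Prop_irrelevance.
Qed.

Lemma smoothP (f : M -> R) : f \in smooth <-> smooth_on setT f.
Proof. by split=> [/asboolP|?]//; exact/asboolP. Qed.

Definition vfield_apply (X : vfield) (f : Cinf M) : Cinf M :=
  MkCinf (asboolT (vfield_smooth X f) : (fun p => X p f) \in smooth).

Let add_subproof (X Y : vfield) : smooth_section_on setT (fun p => X p + Y p).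
Proof.
by move=> f; apply/smoothP;
  exact: (Cinf_smooth (vfield_apply X f + vfield_apply Y f)).
Qed.

Let opp_subproof (X : vfield) : smooth_section_on setT (fun p => - X p).
Proof.
by move=> f; apply/smoothP; exact: (Cinf_smooth (- vfield_apply X f)).
Qed.

Let scale_subproof (h : Cinf M) (X : vfield) :
  smooth_section_on setT (fun p => h p *: X p).
Proof.
by move=> f; apply/smoothP; exact: (Cinf_smooth (h * vfield_apply X f)).
Qed.

Let zero_subproof : smooth_section_on setT (fun p => 0 : tangent p).
Proof. by move=> f; apply/smoothP; exact: (Cinf_smooth (0 : Cinf M)). Qed.

Definition vfield_zero := MkVfield zero_subproof.
Definition vfield_opp X := MkVfield (@opp_subproof X).
Definition vfield_add X Y := MkVfield (@add_subproof X Y).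
Definition vfield_scale h X := MkVfield (@scale_subproof h X).

Let addA : associative vfield_add.
Proof. by move=> X Y Z; apply: vfield_ext => p; exact: addrA. Qed.
Let addC : commutative vfield_add.
Proof. by move=> X Y; apply: vfield_ext => p; exact: addrC. Qed.
Let add0 : left_id vfield_zero vfield_add.
Proof. by move=> X; apply: vfield_ext => p; exact: add0r. Qed.
Let addN : left_inverse vfield_zero vfield_opp vfield_add.
Proof. by move=> X; apply: vfield_ext => p; exact: addNr. Qed.

HB.instance Definition _ := GRing.isZmodule.Build vfield addA addC add0 addN.

Let scaleA f h X : vfield_scale f (vfield_scale h X) = vfield_scale (f * h) X.
Proof. by apply: vfield_ext => p; exact: scalerA. Qed.
Let scale1 : left_id 1 vfield_scale.
Proof. by move=> X; apply: vfield_ext => p; exact: scale1r. Qed.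
Let scaleDr : right_distributive vfield_scale +%R.
Proof. by move=> f X Y; apply: vfield_ext => p; exact: scalerDr. Qed.
Let scaleDl X : {morph vfield_scale^~ X : f h / f + h}.
Proof. by move=> f h; apply: vfield_ext => p; exact: scalerDl. Qed.

HB.instance Definition _ := GRing.Zmodule_isLmodule.Build (Cinf M) vfield
  scaleA scale1 scaleDr scaleDl.

Lemma vfieldDE (X Y : vfield) p : (X + Y) p = X p + Y p. Proof. by []. Qed.
Lemma vfieldNE (X : vfield) p : (- X) p = - X p. Proof. by []. Qed.
Lemma vfieldZE (f : Cinf M) (X : vfield) p : (f *: X) p = f p *: X p.
Proof. by []. Qed.

Definition bracket_fun (X Y : vfield) (p : M) : Cinf M -> R^o :=
  fun f => X p (vfield_apply Y f) - Y p (vfield_apply X f).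

Lemma bracket_derivation X Y p : bracket_fun X Y p \in derivation_at p.
Proof.
have lin (Z : vfield) a f h :
    vfield_apply Z (Cinf_cst M a * f + h) =
    Cinf_cst M a * vfield_apply Z f + vfield_apply Z h.
  by apply: Cinf_ext => q; rewrite /= tangent_lin.
have mul (Z : vfield) f h :
    vfield_apply Z (f * h) = vfield_apply Z f * h + f * vfield_apply Z h.
  by apply: Cinf_ext => q; rewrite /= tangentM.
apply/asboolP; rewrite /bracket_fun; split=> *.
  by rewrite !lin !tangent_lin; ring.
by rewrite !mul !tangentD !tangentM /=; ring.
Qed.

Let bracket_smooth X Y :
  smooth_section_on setT (fun p => MkTangent (bracket_derivation X Y p)).
Proof.
move=> f; apply/smoothP.
exact: (Cinf_smooth (vfield_apply X (vfield_apply Y f)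
                     - vfield_apply Y (vfield_apply X f))).
Qed.

Definition bracket (X Y : vfield) : vfield := MkVfield (@bracket_smooth X Y).

End VectorFields.
Arguments vfield {R m} M.

Section Riemannian.
Context {R : realType} {m : nat} {M : smooth_manifold R m}.

Record riemannian_metric := RiemannianMetric {
  rmetric_at :> forall p : M, tangent p -> tangent p -> R;
  rmetric_sym : forall p (u v : tangent p), rmetric_at u v = rmetric_at v u;
  rmetric_linear : forall p (a : R) (u v w : tangent p),
    rmetric_at (a *: u + v) w = a * rmetric_at u w + rmetric_at v w;
  rmetric_posdef : forall p (u : tangent p), u != 0 -> 0 < rmetric_at u u;
  rmetric_smooth : forall X Y : vfield M,
    (fun p => rmetric_at (X p) (Y p)) \in smooth
}.

Definition inner (g : riemannian_metric) (X Y : vfield M) : Cinf M :=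
  MkCinf (rmetric_smooth g X Y).

Record connection (nabla : vfield M -> vfield M -> vfield M) : Prop := {
  connection_linear : forall (f : Cinf M) X Y Z,
    nabla (f *: X + Y) Z = f *: nabla X Z + nabla Y Z;
  connection_additive : forall X Y Z,
    nabla X (Y + Z) = nabla X Y + nabla X Z;
  connection_leibniz : forall (f : Cinf M) X Y,
    nabla X (f *: Y) = vfield_apply X f *: Y + f *: nabla X Y
}.

Record levi_civita (g : riemannian_metric)
    (nabla : vfield M -> vfield M -> vfield M) : Prop := {
  levi_civita_connection : connection nabla;
  levi_civita_torsion_free : forall X Y,
    nabla X Y - nabla Y X = bracket X Y;
  levi_civita_metric : forall X Y Z,
    vfield_apply X (inner g Y Z) =
    inner g (nabla X Y) Z + inner g Y (nabla X Z)
}.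

Definition semi_symmetric (g : riemannian_metric)
    (nabla : vfield M -> vfield M -> vfield M) (U X Y : vfield M) : vfield M :=
  nabla X Y + inner g U Y *: X - inner g X Y *: U.

Definition curvature (nabla : vfield M -> vfield M -> vfield M)
    (X Y Z : vfield M) : vfield M :=
  nabla X (nabla Y Z) - nabla Y (nabla X Z) - nabla (bracket X Y) Z.

End Riemannian.
Arguments riemannian_metric {R m} M.

Section Distributions.
Context {R : realType} {m : nat} {M : smooth_manifold R m}.

Definition local_frame (n : nat) (D : forall p : M, set (tangent p))
    (V : set M) (e : 'I_n -> forall p : M, tangent p) : Prop :=
  (forall i, smooth_section_on V (e i)) /\
  (forall p, V p ->
     let comb (c : 'rV[R]_n) := \sum_(i < n) c 0 i *: e i p in
     injective comb /\ D p = range comb).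

Record smooth_distribution (n : nat) := SmoothDistribution {
  fiber :> forall p : M, set (tangent p);
  distribution_frame : forall p, exists V : set M,
    [/\ open V, V p & exists e : 'I_n -> forall q : M, tangent q,
      local_frame fiber V e]
}.

(* The space Gamma(E) of smooth sections of a family E of subspaces. *)
Definition sections (E : forall p : M, set (tangent p)) : set (vfield M) :=
  [set X | forall p, E p (X p)].

Definition orth_complement (g : riemannian_metric M)
    (D : forall p : M, set (tangent p)) (p : M) : set (tangent p) :=
  [set v | forall w, D p w -> g p v w = 0].

Definition nonintegrable (D : forall p : M, set (tangent p)) : Prop :=
  exists X Y, [/\ sections D X, sections D Y & ~ sections D (bracket X Y)].

(* The projections TM -> D and TM -> D^perp acting on vector fields.  The
   decomposition is unique, so this determines piD and piDp. *)
Definition orthogonal_projections (g : riemannian_metric M)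
    (D : forall p : M, set (tangent p))
    (piD piDp : vfield M -> vfield M) : Prop :=
  forall X, [/\ sections D (piD X), sections (orth_complement g D) (piDp X) &
                X = piD X + piDp X].

(* Only the values A xi X with xi in Gamma(D^perp) and X in Gamma(D) are
   constrained; on these A is uniquely determined. *)
Definition shape_operator (g : riemannian_metric M)
    (D : forall p : M, set (tangent p))
    (B A : vfield M -> vfield M -> vfield M) : Prop :=
  forall xi X, sections (orth_complement g D) xi -> sections D X ->
    sections D (A xi X) /\
    forall Y, sections D Y -> inner g (A xi X) Y = inner g (B X Y) xi.

(* B(X,Y) when nabla is the Levi-Civita connection, B~(X,Y) when it is the
   semi-symmetric metric connection. *)
Definition second_form (piDp : vfield M -> vfield M)
    (nabla : vfield M -> vfield M -> vfield M) (X Y : vfield M) : vfield M :=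
  piDp (nabla X Y).

Definition normal_connection (piDp : vfield M -> vfield M)
    (nabla : vfield M -> vfield M -> vfield M) (X xi : vfield M) : vfield M :=
  piDp (nabla X xi).

Definition semi_symmetric_shape (g : riemannian_metric M) (U : vfield M)
    (A : vfield M -> vfield M -> vfield M) (xi X : vfield M) : vfield M :=
  A xi X - inner g U xi *: X.

Definition normal_curvature (g : riemannian_metric M)
    (nabla : vfield M -> vfield M -> vfield M) (U : vfield M)
    (piD piDp : vfield M -> vfield M) (X Y xi : vfield M) : vfield M :=
  let L := normal_connection piDp nabla in
  L X (L Y xi) - L Y (L X xi) - L (piD (bracket X Y)) xi
  - piDp (semi_symmetric g nabla U (piDp (bracket X Y)) xi).

End Distributions.
Arguments smooth_distribution {R m} M n.

(* Main.v *)
Require Import Defs.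
From HB Require Import structures.
From mathcomp Require Import all_boot all_order all_algebra.
From mathcomp Require Import all_classical all_reals all_analysis.

Set Implicit Arguments.
Unset Strict Implicit.
Unset Printing Implicit Defensive.

Import Order.TTheory GRing.Theory Num.Theory.
Import numFieldNormedType.Exports.

Local Open Scope classical_set_scope.
Local Open Scope ring_scope.

(** The identity is the normal part of the Weingarten formula
      nabla~_X xi = - A~_xi X + L_X xi,
    differentiated once more.  Metric compatibility applied to g(xi, Y) = 0
    shows that the tangential part of nabla_X xi is - A_xi X ([weingarten]);
    since g(X, xi) = 0, passing to the semi-symmetric connection only adds the
    tangential term omega(xi) X, which turns A into A~ and leaves the normal
    part L_X xi unchanged ([semi_symmetric_weingarten],
    [normal_semi_symmetric]).

    In R~(X,Y) xi, the iterated derivative nabla~_X (- A~_xi Y + L_Y xi) has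
    normal part - B~(X, A~_xi Y) + L_X L_Y xi, and symmetrically in X and Y.
    The bracket [X,Y] need not be tangent to D, so nabla~_[X,Y] xi is split
    along [X,Y] = [X,Y]^D + [X,Y]^Dp: the first piece has normal part
    L_([X,Y]^D) xi, and the second one is a term of the normal curvature as it
    stands.

    The projections are given only by the decomposition X = piD X + piDp X;
    they are additive because a section of D that is orthogonal to D vanishes,
    the metric being positive definite. *)

Section NormalCurvature.
Context {R : realType} {m n : nat} {M : smooth_manifold R m}.
Variables (g : riemannian_metric M) (D : smooth_distribution M n).
Implicit Types (X Y Z U V xi : vfield M) (f : Cinf M).

Local Notation Dp := (orth_complement g D).

Lemma innerC X Y : inner g X Y = inner g Y X.
Proof. by apply: Cinf_ext => p; exact: rmetric_sym. Qed.

Lemma innerDl X Y Z : inner g (X + Y) Z = inner g X Z + inner g Y Z.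
Proof.
apply: Cinf_ext => p; have := rmetric_linear g 1 (X p) (Y p) (Z p).
by rewrite scale1r mul1r.
Qed.

Lemma innerDr X Y Z : inner g Z (X + Y) = inner g Z X + inner g Z Y.
Proof. by rewrite innerC innerDl !(innerC Z). Qed.

Lemma rmetricZl p (a : R) (u w : tangent p) : g p (a *: u) w = a * g p u w.
Proof.
have g0 : g p 0 w = 0.
  have := rmetric_linear g 1 0 0 w; rewrite scale1r mul1r addr0.
  by move/eqP; rewrite -subr_eq0 opprD addNKr oppr_eq0 => /eqP.
by have := rmetric_linear g a u 0 w; rewrite addr0 g0 addr0.
Qed.

(** A local frame presents each fiber of D as the range of a linear map. *)
Lemma fiber_linear p (a : R) (u v : tangent p) :
  D p u -> D p v -> D p (a *: u + v).
Proof.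
have [V [_ Vp [e [_ /(_ p Vp)[_ ->]]]]] := distribution_frame D p.
move=> [c _ <-] [d _ <-]; exists (a *: c + d) => //.
rewrite scaler_sumr -big_split; apply: eq_bigr => i _ /=.
by rewrite !mxE scalerDl scalerA.
Qed.

Lemma sections_linear f X Y :
  sections D X -> sections D Y -> sections D (f *: X + Y).
Proof. by move=> DX DY p; exact: fiber_linear. Qed.

Lemma orth_sections_linear f X Y :
  sections Dp X -> sections Dp Y -> sections Dp (f *: X + Y).
Proof.
move=> DX DY p w Dw; rewrite vfieldDE vfieldZE rmetric_linear.
by rewrite (DX p) // (DY p) // mulr0 addr0.
Qed.

Lemma inner_orth X xi : sections D X -> sections Dp xi -> inner g xi X = 0.
Proof. by move=> DX Dxi; apply: Cinf_ext => p; exact: Dxi. Qed.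

(** Testing X against itself suffices, by positive definiteness; this is how
    equalities in Gamma(D) are reduced to equalities of inner products. *)
Lemma section_inner_eq0 X : sections D X ->
  (forall Y, sections D Y -> inner g X Y = 0) -> X = 0.
Proof.
move=> DX /(_ X DX) XX0; apply: vfield_ext => p.
case: (eqVneq (X p) 0) => [//|/(rmetric_posdef g)].
have -> : g p (X p) (X p) = inner g X X p by [].
by rewrite XX0 ltxx.
Qed.

Section Projections.
Variables piD piDp : vfield M -> vfield M.
Hypothesis hpi : orthogonal_projections g D piD piDp.

(** The orthogonal decomposition of a vector field is unique: the difference
    of two tangential parts is also a difference of normal parts. *)
Lemma orth_decomp_unique Y Z : sections D Y -> sections Dp Z ->
  piD (Y + Z) = Y /\ piDp (Y + Z) = Z.
Proof.
move=> DY DZ; have [DP DQ E] := hpi (Y + Z).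
set P := piD _ in DP E *; set Q := piDp _ in DQ E *.
have DPY : sections D (-1 *: Y + P) by exact: sections_linear.
have PY : -1 *: Y + P = -1 *: Q + Z.
  by rewrite !scaleN1r [RHS]addrC -{1}[Z](addKr Y) E addrA addrK.
have P0 : -1 *: Y + P = 0.
  apply: section_inner_eq0 => // V DV; apply: inner_orth => //.
  by rewrite PY; exact: orth_sections_linear.
have PeqY : P = Y by apply/eqP; rewrite -subr_eq0 addrC -scaleN1r P0.
by split=> //; apply: (addrI P); rewrite -E PeqY.
Qed.

Lemma normal_tangent X : sections D X -> piDp X = 0.
Proof.
move=> DX; rewrite -{1}[X]addr0; apply: (orth_decomp_unique DX _).2.
by move=> p w _; have := rmetricZl 0 (X p) w; rewrite scale0r mul0r.
Qed.

Lemma normalD X Y : piDp (X + Y) = piDp X + piDp Y.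
Proof.
have [DX NX EX] := hpi X; have [DY NY EY] := hpi Y.
rewrite {1}EX {1}EY addrACA -[piD X]scale1r -[piDp X in LHS]scale1r.
rewrite (orth_decomp_unique _ _).2 ?scale1r //.
  by rewrite -[piD X]scale1r; exact: sections_linear.
by rewrite -[piDp X]scale1r; exact: orth_sections_linear.
Qed.

Lemma normalN X : piDp (- X) = - piDp X.
Proof.
have N0 : piDp 0 = 0 by apply: (addrI (piDp 0)); rewrite -normalD !addr0.
by apply/eqP; rewrite -subr_eq0 opprK -normalD addNr N0.
Qed.

Lemma inner_tangent_part X Y : sections D Y -> inner g (piD X) Y = inner g X Y.
Proof.
move=> DY; have [_ NX {2}->] := hpi X.
by rewrite innerDl (inner_orth DY NX) addr0.
Qed.

Lemma inner_normal_part X xi : sections Dp xi ->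
  inner g (piDp X) xi = inner g X xi.
Proof.
move=> Nxi; have [DX _ {2}->] := hpi X.
by rewrite innerDl [inner g (piD X) _]innerC (inner_orth DX Nxi) add0r.
Qed.

Section Connection.
Variable nabla : vfield M -> vfield M -> vfield M.
Hypothesis hnabla : levi_civita g nabla.
Variable U : vfield M.
Local Notation nablat := (semi_symmetric g nabla U).
Local Notation L := (normal_connection piDp nabla).

Lemma semi_symmetricDr X Y Z : nablat X (Y + Z) = nablat X Y + nablat X Z.
Proof.
rewrite /semi_symmetric (connection_additive (levi_civita_connection hnabla)).
by rewrite !innerDr !scalerDl opprD (addrACA (nabla X Y)) [LHS]addrACA.
Qed.

Lemma semi_symmetricNr X Y : nablat X (- Y) = - nablat X Y.
Proof.
have N0 : nablat X 0 = 0.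
  by apply: (addrI (nablat X 0)); rewrite -semi_symmetricDr !addr0.
by apply/eqP; rewrite -subr_eq0 opprK -semi_symmetricDr addNr N0.
Qed.

Lemma semi_symmetricDl X Y Z : nablat (X + Y) Z = nablat X Z + nablat Y Z.
Proof.
rewrite /semi_symmetric.
have := connection_linear (levi_civita_connection hnabla) 1 X Y Z.
rewrite !scale1r => ->; rewrite innerDl scalerDr scalerDl opprD.
by rewrite (addrACA (nabla X Z)) [LHS]addrACA.
Qed.

Lemma semi_symmetric_normal X xi : sections D X -> sections Dp xi ->
  nablat X xi = nabla X xi + inner g U xi *: X.
Proof.
move=> DX Nxi.
by rewrite /semi_symmetric [inner g X _]innerC (inner_orth DX Nxi) scale0r subr0.
Qed.

(** The correction omega(xi) X is tangent to D. *)
Lemma normal_semi_symmetric X xi : sections D X -> sections Dp xi ->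
  piDp (nablat X xi) = L X xi.
Proof.
move=> DX Nxi; rewrite semi_symmetric_normal // normalD.
rewrite (@normal_tangent (_ *: X)) ?addr0 // -[_ *: X]addr0.
apply: sections_linear => // p.
by rewrite -(addNr X) -scaleN1r; exact: sections_linear.
Qed.

Section Shape.
Variable A : vfield M -> vfield M -> vfield M.
Hypothesis hA : shape_operator g D (second_form piDp nabla) A.

(** Differentiating g(xi, Y) = 0 along X gives
    g(nabla_X xi, Y) = - g(xi, nabla_X Y) = - g(A_xi X, Y). *)
Lemma weingarten X xi : sections D X -> sections Dp xi ->
  nabla X xi = - A xi X + L X xi.
Proof.
move=> DX Nxi; have [DA gA] := hA Nxi DX.
have [DP _ E] := hpi (nabla X xi); rewrite {1}E; congr (_ + _).
apply/eqP; rewrite -addr_eq0; apply/eqP.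
apply: section_inner_eq0 => [|Y DY].
  by rewrite -[piD _]scale1r; exact: sections_linear.
rewrite innerDl inner_tangent_part // gA // inner_normal_part //.
have := levi_civita_metric hnabla X xi Y; rewrite (inner_orth DY Nxi).
have -> : vfield_apply X 0 = 0.
  by apply: Cinf_ext => p /=; have := tangentB (X p) 0 0; rewrite !subrr.
by rewrite [inner g xi _]innerC => <-.
Qed.

Lemma semi_symmetric_weingarten X xi : sections D X -> sections Dp xi ->
  nablat X xi = - semi_symmetric_shape g U A xi X + L X xi.
Proof.
move=> DX Nxi; rewrite semi_symmetric_normal // weingarten //.
by rewrite /semi_symmetric_shape opprB addrAC [_ - A _ _]addrC.
Qed.

(** Applying the Weingarten formula to nabla~_Y xi, the tangential part
    contributes through B~, and the normal part L_Y xi is again a normal field,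
    so its derivative has normal part L_X L_Y xi. *)
Lemma normal_semi_symmetric2 X Y xi :
  sections D X -> sections D Y -> sections Dp xi ->
  piDp (nablat X (nablat Y xi)) =
    - second_form piDp nablat X (semi_symmetric_shape g U A xi Y)
    + L X (L Y xi).
Proof.
move=> DX DY Nxi; rewrite (semi_symmetric_weingarten DY Nxi).
rewrite semi_symmetricDr normalD semi_symmetricNr normalN.
have [_ NL _] := hpi (nabla Y xi).
by rewrite (normal_semi_symmetric DX NL).
Qed.

End Shape.
End Connection.
End Projections.
End NormalCurvature.

Theorem theorem2p8 (R : realType) (m n : nat) (M : smooth_manifold R m)
    (g : riemannian_metric M) (nabla : vfield M -> vfield M -> vfield M)
    (hnabla : levi_civita g nabla)
    (D : smooth_distribution M n) (hD : nonintegrable D)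
    (piD piDp : vfield M -> vfield M)
    (hpi : orthogonal_projections g D piD piDp)
    (A : vfield M -> vfield M -> vfield M)
    (hA : shape_operator g D (second_form piDp nabla) A)
    (U : vfield M) (X Y xi : vfield M) :
  sections D X -> sections D Y -> sections (orth_complement g D) xi ->
  let nablat := semi_symmetric g nabla U in
  let Bt := second_form piDp nablat in
  let At := semi_symmetric_shape g U A in
  piDp (curvature nablat X Y xi) =
    - Bt X (At xi Y) + Bt Y (At xi X)
    + normal_curvature g nabla U piD piDp X Y xi.
Proof.
move=> DX DY Nxi /=.
have [DB _ EB] := hpi (bracket X Y).
rewrite /curvature 2!(normalD hpi) 2!(normalN hpi).
rewrite !(normal_semi_symmetric2 hpi hnabla U hA) // {1}EB.
rewrite (semi_symmetricDl hnabla) (normalD hpi) (normal_semi_symmetric hpi) //.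
rewrite /normal_curvature !opprD opprK.
by rewrite !addrA; congr (_ - _ - _); congr (_ - _); rewrite addrAC.
Qed.
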